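(* The Brownian momentum process on two sites is self-dual with self-duality function $D(x,y)=\tilde J(x_1,y_1)\,\tilde J(x_2,y_2)$, where $$\tilde J(x,y)=e^{\frac12(x^2+y^2)}\sqrt{\frac{2}{\pi}}\,\cos(xy),\qquad x,y\in\mathbb{R}.$$ That is, with $L$ the generator of the process on two sites, $$[L D(\cdot,y)](x)=[L D(x,\cdot)](y)\qquad\text{for all } x=(x_1,x_2),\ y=(y_1,y_2)\in\mathbb{R}^2 .$$
   Context: The Brownian momentum process (BMP) on two sites is the diffusion process on $\mathbb{R}^2$ with generator $$(Lf)(x_1,x_2)=\left(x_1\frac{\partial}{\partial x_2}-x_2\frac{\partial}{\partial x_1}\right)^2f(x_1,x_2),$$ where the square denotes the composition of the first-order differential operator with itself; $L$ acts as this differential operator on smooth functions. A process with generator $L$ and state space $\mathcal{S}$ is called self-dual with self-duality function $D:\mathcal{S}\times\mathcal{S}\to\mathbb{R}$ if $[LD(\cdot,y)](x)=[LD(x,\cdot)](y)$ for all $x,y\in\mathcal{S}$; on the left $L$ acts on $D$ as a function of the first argument, on the right as a function of the second argument. *)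

(* Defs.v *)
From Stdlib Require Import Reals.
From Coquelicot Require Import Coquelicot.
Open Scope R_scope.

Definition partial1 (f : R * R -> R) (x : R * R) : R :=
  Derive (fun t => f (t, snd x)) (fst x).

Definition partial2 (f : R * R -> R) (x : R * R) : R :=
  Derive (fun t => f (fst x, t)) (snd x).

Fixpoint Ck (k : nat) (f : R * R -> R) : Prop :=
  (forall x : R * R, continuous f x) /\
  match k with
  | O => True
  | S j =>
      (forall x : R * R,
         ex_derive (fun t => f (t, snd x)) (fst x) /\
         ex_derive (fun t => f (fst x, t)) (snd x)) /\
      Ck j (partial1 f) /\ Ck j (partial2 f)
  end.

Definition smooth (f : R * R -> R) : Prop := forall k : nat, Ck k f.

(* [Derive] is total, with an unspecified value where the derivative does not
   exist, so [BMP_generator f] is meaningful only for regular [f]; [smooth] is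
   its domain. *)
Definition rotation_field (f : R * R -> R) (x : R * R) : R :=
  fst x * partial2 f x - snd x * partial1 f x.

Definition BMP_generator (f : R * R -> R) : R * R -> R :=
  rotation_field (rotation_field f).

(* The first two clauses say that both sides of the duality identity apply [L]
   to functions in its domain [dom], on which alone [L] is meaningful. *)
Definition self_dual {St : Type} (dom : (St -> R) -> Prop)
    (L : (St -> R) -> St -> R) (D : St -> St -> R) : Prop :=
  (forall y : St, dom (fun x => D x y)) /\
  (forall x : St, dom (fun y => D x y)) /\
  (forall x y : St, L (fun x' => D x' y) x = L (fun y' => D x y') y).

Definition Jtilde (x y : R) : R :=
  exp (1 / 2 * (x ^ 2 + y ^ 2)) * sqrt (2 / PI) * cos (x * y).

Definition BMP_duality (x y : R * R) : R :=
  Jtilde (fst x) (fst y) * Jtilde (snd x) (snd y).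

(* Main.v *)
Require Import Defs.
From Stdlib Require Import Reals FunctionalExtensionality.
From Coquelicot Require Import Coquelicot.
Open Scope R_scope.

(** The rotation field annihilates the radial factor [exp (|x|^2 / 2)], so the
    generator only acts on [cos (x1 y1) cos (x2 y2)], and the result is visibly
    symmetric under exchanging [x] and [y]. Smoothness holds because the two
    factors of [D] belong to a class of one-variable functions that is stable
    under differentiation. *)

(** Each partial derivative differentiates one factor and freezes the other, giving again a product
    of two members of [F]. Hence the induction on [k] keeps [g] and [h] general. Continuity comes
    from differentiability of the factors. *)
Lemma Ck_tensor (F : (R -> R) -> Prop) :
  (forall g, F g -> exists g', F g' /\ forall t : R, is_derive g t (g' t)) ->
  forall k g h, F g -> F h -> Ck k (fun x => g (fst x) * h (snd x)).
Proof.
  intros HF k; induction k as [|k IH]; intros g h Fg Fh;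
    destruct (HF g Fg) as [g' [Fg' dg]]; destruct (HF h Fh) as [h' [Fh' dh]];
    (assert (cont : forall x : R * R,
               continuous (fun x => g (fst x) * h (snd x)) x);
     [ intros [x1 x2];
       apply (continuous_mult (fun x : R * R => g (fst x)) (fun x => h (snd x)));
       [ apply (continuous_comp fst g); [apply continuous_fst|]
       | apply (continuous_comp snd h); [apply continuous_snd|] ];
       [ apply (ex_derive_continuous g); now exists (g' x1)
       | apply (ex_derive_continuous h); now exists (h' x2) ] | ]).
  - split; [exact cont | exact I].
  - assert (d1 : forall x1 x2 : R,
              is_derive (fun t => g t * h x2) x1 (g' x1 * h x2)).
    { intros x1 x2; specialize (dg x1).
      auto_derive; [now exists (g' x1) | rewrite (is_derive_unique (fun t : R => g t) _ _ dg); ring]. }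
    assert (d2 : forall x1 x2 : R,
              is_derive (fun t => g x1 * h t) x2 (g x1 * h' x2)).
    { intros x1 x2; specialize (dh x2).
      auto_derive; [now exists (h' x2) | rewrite (is_derive_unique (fun t : R => h t) _ _ dh); ring]. }
    split; [exact cont | split; [|split]].
    + intros [x1 x2]; split;
        [exists (g' x1 * h x2); exact (d1 x1 x2) | exists (g x1 * h' x2); exact (d2 x1 x2)].
    + assert (E : partial1 (fun x => g (fst x) * h (snd x)) =
                  (fun x => g' (fst x) * h (snd x))).
      { apply functional_extensionality; intros [x1 x2].
        exact (is_derive_unique _ _ _ (d1 x1 x2)). }
      rewrite E; exact (IH g' h Fg' Fh).
    + assert (E : partial2 (fun x => g (fst x) * h (snd x)) =
                  (fun x => g (fst x) * h' (snd x))).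
      { apply functional_extensionality; intros [x1 x2].
        exact (is_derive_unique _ _ _ (d2 x1 x2)). }
      rewrite E; exact (IH g h' Fg Fh').
Qed.

Inductive gauss_trig : (R -> R) -> Prop :=
| gt_const c : gauss_trig (fun _ => c)
| gt_id : gauss_trig (fun t => t)
| gt_gauss c : gauss_trig (fun t => exp (1 / 2 * (t ^ 2 + c)))
| gt_cos c : gauss_trig (fun t => cos (t * c))
| gt_sin c : gauss_trig (fun t => sin (t * c))
| gt_plus g h : gauss_trig g -> gauss_trig h -> gauss_trig (fun t => g t + h t)
| gt_mult g h : gauss_trig g -> gauss_trig h -> gauss_trig (fun t => g t * h t).

Lemma gauss_trig_derive g :
  gauss_trig g -> exists g', gauss_trig g' /\ forall t : R, is_derive g t (g' t).
Proof.
  induction 1 as [c| |c|c|c|g h Fg [g' [Fg' dg]] Fh [h' [Fh' dh]]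
                 |g h Fg [g' [Fg' dg]] Fh [h' [Fh' dh]]].
  - exists (fun _ => 0); split; [constructor|].
    intros t; auto_derive; [exact I | ring].
  - exists (fun _ => 1); split; [constructor|].
    intros t; auto_derive; [exact I | ring].
  - exists (fun t => t * exp (1 / 2 * (t ^ 2 + c))); split; [repeat constructor|].
    intros t; auto_derive; [exact I | simpl; field].
  - exists (fun t => - c * sin (t * c)); split; [repeat constructor|].
    intros t; auto_derive; [exact I | ring].
  - exists (fun t => c * cos (t * c)); split; [repeat constructor|].
    intros t; auto_derive; [exact I | ring].
  - exists (fun t => g' t + h' t); split; [now constructor|].
    intros t; now apply (is_derive_plus g h).
  - exists (fun t => g' t * h t + g t * h' t); split; [now repeat constructor|].
    intros t; specialize (dg t); specialize (dh t).
    auto_derive; [split; [now exists (g' t) | split; [now exists (h' t) | exact I]]|].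
    rewrite (is_derive_unique (fun t : R => g t) _ _ dg), (is_derive_unique (fun t : R => h t) _ _ dh); ring.
Qed.

Lemma BMP_duality_smooth y : smooth (fun x => BMP_duality x y).
Proof.
  intros k.
  apply (Ck_tensor gauss_trig gauss_trig_derive k
           (fun t => Jtilde t (fst y)) (fun t => Jtilde t (snd y)));
    (* [Jtilde] unfolds to Gaussian times constant times cosine. *)
    repeat constructor.
Qed.

Lemma BMP_duality_sym x y : BMP_duality x y = BMP_duality y x.
Proof.
  unfold BMP_duality, Jtilde.
  now rewrite (Rplus_comm (fst x ^ 2)), (Rplus_comm (snd x ^ 2)),
    (Rmult_comm (fst x) (fst y)), (Rmult_comm (snd x) (snd y)).
Qed.

(** This is $\frac{2}{\pi}e^{(|x|^2+|y|^2)/2}$, kept as separate exponentials so that [field] meets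
    the same atoms as in [BMP_duality]. *)
Definition radial_factor (x y : R * R) : R :=
  exp (1 / 2 * (fst x ^ 2 + fst y ^ 2)) * sqrt (2 / PI) *
  (exp (1 / 2 * (snd x ^ 2 + snd y ^ 2)) * sqrt (2 / PI)).

Lemma radial_factor_sym x y : radial_factor x y = radial_factor y x.
Proof.
  unfold radial_factor.
  now rewrite (Rplus_comm (fst x ^ 2)), (Rplus_comm (snd x ^ 2)).
Qed.

(** An equality of functions is needed here, since the result is differentiated once more. *)
Lemma rotation_field_BMP_duality y :
  rotation_field (fun x => BMP_duality x y) =
  fun x => radial_factor x y *
    (snd x * fst y * sin (fst x * fst y) * cos (snd x * snd y) -
     fst x * snd y * cos (fst x * fst y) * sin (snd x * snd y)).
Proof.
  apply functional_extensionality; intros [x1 x2]; destruct y as [y1 y2].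
  unfold rotation_field, partial1, partial2, BMP_duality, Jtilde, radial_factor.
  cbn [fst snd].
  (* The values of the two partial derivatives stay existential until [auto_derive] computes them
     and [reflexivity] fixes them. *)
  erewrite (is_derive_unique _ x2), (is_derive_unique _ x1);
    [ | auto_derive; [exact I | reflexivity] ..].
  simpl; field; apply PI_neq0.
Qed.

(** Apart from the radial factor, $x$ and $y$ enter only through $x_1y_1$, $x_2y_2$ and
    $(x_1y_2)^2+(x_2y_1)^2$, all unchanged when $x$ and $y$ are swapped. *)
Lemma BMP_generator_BMP_duality x y :
  BMP_generator (fun x' => BMP_duality x' y) x =
  radial_factor x y *
    (fst x * fst y * sin (fst x * fst y) * cos (snd x * snd y) +
     snd x * snd y * cos (fst x * fst y) * sin (snd x * snd y) -
     2 * (fst x * fst y) * (snd x * snd y) *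
       sin (fst x * fst y) * sin (snd x * snd y) -
     ((fst x * snd y) ^ 2 + (snd x * fst y) ^ 2) *
       cos (fst x * fst y) * cos (snd x * snd y)).
Proof.
  unfold BMP_generator; rewrite rotation_field_BMP_duality.
  destruct x as [x1 x2], y as [y1 y2].
  unfold rotation_field, partial1, partial2, radial_factor.
  cbn [fst snd].
  erewrite (is_derive_unique _ x2), (is_derive_unique _ x1);
    [ | auto_derive; [exact I | reflexivity] ..].
  simpl; field; apply PI_neq0.
Qed.

Theorem theorem4p9 : self_dual smooth BMP_generator BMP_duality.
Proof.
  assert (sym : forall x, (fun y => BMP_duality x y) = (fun y => BMP_duality y x)).
  { intros x; apply functional_extensionality; intros y; apply BMP_duality_sym. }
  split; [|split].
  - exact BMP_duality_smooth.
  - intros x; rewrite (sym x); exact (BMP_duality_smooth x).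
  - intros x y.
    (* By symmetry of $D$, acting on the second argument is acting on the first with the points
       exchanged, so one formula serves both sides. *)
    rewrite (sym x).
    rewrite (BMP_generator_BMP_duality x y).
    rewrite (BMP_generator_BMP_duality y x).
    rewrite (radial_factor_sym y x).
    (* The arguments of [sin] and [cos] must agree syntactically before [ring] can identify these
       terms. *)
    rewrite (Rmult_comm (fst y) (fst x)), (Rmult_comm (snd y) (snd x)).
    ring.
Qed.
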